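(* Let $I,J\ge 0$ be integers, let $Q_0,\dots,Q_I:(0,1)\to\mathbb{R}$ and $B_0,\dots,B_J:\mathcal{X}\to\mathbb{R}$ be functions with $Q_0\equiv 1$ and $B_0\equiv 1$, where $\mathcal{X}$ is a set (of factor values), and let $\bm{a}=(a_{ij})_{0\le i\le I,\,0\le j\le J}$ be real coefficients. Define $$G(p,\bm{x},\bm{a})=\sum_{i=0}^{I}\sum_{j=0}^{J}a_{ij}\,B_j(\bm{x})\,Q_i(p).$$ Suppose that $Q_1,\dots,Q_I$ are nondecreasing, that $B_1,\dots,B_J$ are nonnegative on $\mathcal{X}$, and that $a_{ij}\ge 0$ for all $i\ne 0$ and all $j$. Then $G$ is noncrossing: for all $\bm{x}\in\mathcal{X}$ and all $p_1,p_2$ with $0<p_1<p_2<1$, $$G(p_1,\bm{x},\bm{a})\le G(p_2,\bm{x},\bm{a}).$$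
   Context: $G(p,\bm{x},\bm{a})$ models the $p$-quantile of a response variable conditioned on the factor value $\bm{x}$; $Q_i$ are called basis quantile functions and $B_j$ basis spline functions. No sign constraint is placed on the location coefficients $a_{0j}$. *)

(* Defs.v *)
From mathcomp Require Import all_boot all_order all_algebra.
From mathcomp Require Import reals.

Set Implicit Arguments.
Unset Strict Implicit.
Unset Printing Implicit Defensive.

Import Order.TTheory GRing.Theory Num.Theory.
Local Open Scope ring_scope.

(* Quantile functions are total functions on R of which only the values on
   the open interval ]0, 1[ are meaningful; every condition on them is
   restricted to that interval. *)
Definition quantile_model (R : realType) (X : Type) (I J : nat)
    (Q : 'I_I.+1 -> R -> R) (B : 'I_J.+1 -> X -> R)
    (p : R) (x : X) (a : 'M[R]_(I.+1, J.+1)) : R :=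
  \sum_(i < I.+1) \sum_(j < J.+1) a i j * B j x * Q i p.

Definition noncrossing (R : realType) (X : Type) (G : R -> X -> R) : Prop :=
  forall (x : X) (p1 p2 : R), 0 < p1 -> p1 < p2 -> p2 < 1 -> G p1 x <= G p2 x.

(* Main.v *)
Require Import Defs.
From mathcomp Require Import all_boot all_order all_algebra.
From mathcomp Require Import reals.

Set Implicit Arguments.
Unset Strict Implicit.
Unset Printing Implicit Defensive.

Import Order.TTheory GRing.Theory Num.Theory.
Local Open Scope ring_scope.

(** The inequality holds term by term: each summand is a weight [a i j * B j x], free of [p], times
    [Q i p]. For [i != ord0] the weight is nonnegative and [Q i] is nondecreasing on the open unit
    interval; the row [i = ord0] is constant in [p] there. *)

Theorem mainTheorem2 (R : realType) (X : Type) (I J : nat)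
  (Q : 'I_I.+1 -> R -> R) (B : 'I_J.+1 -> X -> R) (a : 'M[R]_(I.+1, J.+1))
  (Q0 : {in `]0, 1[, forall p, Q ord0 p = 1})
  (B0 : forall x, B ord0 x = 1)
  (Q_nondecreasing : forall i : 'I_I.+1, i != ord0 ->
     {in `]0, 1[ &, {homo Q i : p q / p <= q}})
  (B_ge0 : forall j : 'I_J.+1, j != ord0 -> forall x, 0 <= B j x)
  (a_ge0 : forall (i : 'I_I.+1) (j : 'I_J.+1), i != ord0 -> 0 <= a i j) :
  noncrossing (fun p x => quantile_model Q B p x a).
Proof.
move=> x p1 p2 p1_gt0 p1_lt_p2 p2_lt1.
have p1_in : p1 \in `]0, 1[ by rewrite in_itv /= p1_gt0 (lt_trans p1_lt_p2).
have p2_in : p2 \in `]0, 1[ by rewrite in_itv /= p2_lt1 (lt_trans p1_gt0).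
rewrite /quantile_model; apply: ler_sum => i _; apply: ler_sum => j _.
(* Here [a ord0 j] may be negative, but both sides coincide since [Q ord0] is 1 at [p1] and [p2]. *)
have [->|i_neq0] := eqVneq i ord0; first by rewrite !Q0.
apply: ler_wpM2l; last exact: Q_nondecreasing (ltW p1_lt_p2).
apply: mulr_ge0; first exact: a_ge0.
(* [B_ge0] excludes [ord0], where the sign comes from [B ord0 x = 1]. *)
have [->|j_neq0] := eqVneq j ord0; first by rewrite B0.
exact: B_ge0.
Qed.
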